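(* Let $\mathsf a=(\mathsf a_{\ell,\ell'})_{\ell,\ell'\ge0}$, $\mathsf b,\mathsf c,\mathsf d$ (likewise doubly indexed), $\mathsf e=(\mathsf e_\ell)_{\ell\ge0}$, $\mathsf f=(\mathsf f_\ell)_{\ell\ge0}$ be indeterminates. For $n\ge0$ define $$Q'_n=\sum_{\sigma\in\mathfrak D_{2n}}\prod_{i\in\mathrm{Cval}(\sigma)}\mathsf a_{\mathrm{lcross}'(i,\sigma),\mathrm{lnest}'(i,\sigma)}\prod_{i\in\mathrm{Cpeak}(\sigma)}\mathsf b_{\mathrm{ucross}'(i,\sigma),\mathrm{unest}'(i,\sigma)}\prod_{i\in\mathrm{Cdfall}(\sigma)}\mathsf c_{\mathrm{lcross}'(i,\sigma),\mathrm{lnest}'(i,\sigma)}\prod_{i\in\mathrm{Cdrise}(\sigma)}\mathsf d_{\mathrm{ucross}'(i,\sigma),\mathrm{unest}'(i,\sigma)}\prod_{i\in\mathrm{Evenfix}(\sigma)}\mathsf e_{\mathrm{psnest}(i,\sigma)}\prod_{i\in\mathrm{Oddfix}(\sigma)}\mathsf f_{\mathrm{psnest}(i,\sigma)},$$ and let $Q_n$ be defined by the same formula but with the factors $\mathsf a_{\mathrm{ucross}(i,\sigma),\mathrm{unest}(i,\sigma)}$, $\mathsf b_{\mathrm{lcross}(i,\sigma),\mathrm{lnest}(i,\sigma)}$, $\mathsf c_{\mathrm{lcross}(i,\sigma),\mathrm{lnest}(i,\sigma)}$, $\mathsf d_{\mathrm{ucross}(i,\sigma),\mathrm{unest}(i,\sigma)}$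 for cycle valleys, cycle peaks, cycle double falls, cycle double rises respectively. Then $\sum_{n\ge0}Q'_nt^n$ equals the T-type continued fraction with coefficients $\alpha_{2k-1}=\bigl(\sum_{\xi=0}^{k-1}\mathsf a_{k-1-\xi,\xi}\bigr)\bigl(\sum_{\xi=0}^{k-1}\mathsf b_{k-1-\xi,\xi}\bigr)$, $\alpha_{2k}=\bigl(\mathsf e_k+\sum_{\xi=0}^{k-1}\mathsf c_{k-1-\xi,\xi}\bigr)\bigl(\mathsf f_k+\sum_{\xi=0}^{k-1}\mathsf d_{k-1-\xi,\xi}\bigr)$ ($k\ge1$), $\delta_1=\mathsf e_0\mathsf f_0$, $\delta_n=0$ ($n\ge2$); consequently $Q_n=Q'_n$ for all $n\ge0$.
   Context: $\mathfrak D_{2n}$ is the set of permutations $\sigma$ of $[2n]$ with $\sigma(2k-1)\ge2k-1$ and $\sigma(2k)\le2k$ for all $k\in[n]$. $\mathrm{Cval}(\sigma)=\{i:\sigma^{-1}(i)>i<\sigma(i)\}$, $\mathrm{Cpeak}(\sigma)=\{i:\sigma^{-1}(i)<i>\sigma(i)\}$, $\mathrm{Cdrise}(\sigma)=\{i:\sigma^{-1}(i)<i<\sigma(i)\}$, $\mathrm{Cdfall}(\sigma)=\{i:\sigma^{-1}(i)>i>\sigma(i)\}$; $\mathrm{Evenfix}(\sigma),\mathrm{Oddfix}(\sigma)$ are the sets of even/odd fixed points. Statistics: $\mathrm{ucross}(j,\sigma)=\#\{i<j<k<l:k=\sigma(i),l=\sigma(j)\}$, $\mathrm{unest}(j,\sigma)=\#\{i<j<k<l:k=\sigma(j),l=\sigma(i)\}$,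 $\mathrm{lcross}(k,\sigma)=\#\{i<j<k<l:i=\sigma(k),j=\sigma(l)\}$, $\mathrm{lnest}(k,\sigma)=\#\{i<j<k<l:i=\sigma(l),j=\sigma(k)\}$ (counting the remaining three indices); variants: $\mathrm{ucross}'(k,\sigma)=\#\{(i,j,l):i<j<k<l,\ k=\sigma(i),\ l=\sigma(j)\}$, $\mathrm{unest}'(k,\sigma)=\#\{(i,j,l):i<j<k<l,\ k=\sigma(j),\ l=\sigma(i)\}$, $\mathrm{lcross}'(j,\sigma)=\#\{(i,k,l):i<j<k<l,\ i=\sigma(k),\ j=\sigma(l)\}$, $\mathrm{lnest}'(j,\sigma)=\#\{(i,k,l):i<j<k<l,\ i=\sigma(l),\ j=\sigma(k)\}$; for a fixed point $j$, $\mathrm{psnest}(j,\sigma)=\#\{i<j:\sigma(i)>j\}$. The T-type continued fraction with coefficients $(\alpha_n),(\delta_n)$ is $1/(1-\delta_1t-\alpha_1t/(1-\delta_2t-\alpha_2t/(1-\delta_3t-\cdots)))$. *)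

(* Defs.v *)
From HB Require Import structures.
From mathcomp Require Import all_boot all_order all_algebra all_fingroup.

Set Implicit Arguments.
Unset Strict Implicit.
Unset Printing Implicit Defensive.

Import GRing.Theory.
Local Open Scope ring_scope.

(* A permutation of [m] = {1, ..., m} is an element of 'S_m; the ordinal      *)
(* i : 'I_m (with value 0 <= i < m) stands for the integer i + 1.             *)
Definition label (m : nat) (i : 'I_m) : nat := i.+1.

Section Permutations.

Variables (m : nat) (s : 'S_m).

Definition Dperm : bool :=
  [forall i : 'I_m,
     if odd (label i) then (label i <= label (s i))%N
     else (label (s i) <= label i)%N].

Definition Cval : {set 'I_m} :=
  [set i : 'I_m | (i < (s^-1)%g i)%N & (i < s i)%N].
Definition Cpeak : {set 'I_m} :=
  [set i : 'I_m | ((s^-1)%g i < i)%N & (s i < i)%N].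
Definition Cdrise : {set 'I_m} :=
  [set i : 'I_m | ((s^-1)%g i < i)%N & (i < s i)%N].
Definition Cdfall : {set 'I_m} :=
  [set i : 'I_m | (i < (s^-1)%g i)%N & (s i < i)%N].
Definition Evenfix : {set 'I_m} := [set i : 'I_m | s i == i & ~~ odd (label i)].
Definition Oddfix : {set 'I_m} := [set i : 'I_m | s i == i & odd (label i)].

Definition lt4 (i j k l : 'I_m) : bool := [&& i < j, j < k & k < l]%N.

Definition ucross (j : 'I_m) : nat :=
  #|[set x : 'I_m * 'I_m * 'I_m |
      let: (i, k, l) := x in [&& lt4 i j k l, k == s i & l == s j]]|.
Definition unest (j : 'I_m) : nat :=
  #|[set x : 'I_m * 'I_m * 'I_m |
      let: (i, k, l) := x in [&& lt4 i j k l, k == s j & l == s i]]|.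
Definition lcross (k : 'I_m) : nat :=
  #|[set x : 'I_m * 'I_m * 'I_m |
      let: (i, j, l) := x in [&& lt4 i j k l, i == s k & j == s l]]|.
Definition lnest (k : 'I_m) : nat :=
  #|[set x : 'I_m * 'I_m * 'I_m |
      let: (i, j, l) := x in [&& lt4 i j k l, i == s l & j == s k]]|.

Definition ucross' (k : 'I_m) : nat :=
  #|[set x : 'I_m * 'I_m * 'I_m |
      let: (i, j, l) := x in [&& lt4 i j k l, k == s i & l == s j]]|.
Definition unest' (k : 'I_m) : nat :=
  #|[set x : 'I_m * 'I_m * 'I_m |
      let: (i, j, l) := x in [&& lt4 i j k l, k == s j & l == s i]]|.
Definition lcross' (j : 'I_m) : nat :=
  #|[set x : 'I_m * 'I_m * 'I_m |
      let: (i, k, l) := x in [&& lt4 i j k l, i == s k & j == s l]]|.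
Definition lnest' (j : 'I_m) : nat :=
  #|[set x : 'I_m * 'I_m * 'I_m |
      let: (i, k, l) := x in [&& lt4 i j k l, i == s l & j == s k]]|.

Definition psnest (j : 'I_m) : nat :=
  #|[set i : 'I_m | (i < j)%N & (j < s i)%N]|.

End Permutations.

Section MasterPolynomials.

Variables (R : comNzRingType) (a b c d : nat -> nat -> R) (e f : nat -> R).

Definition Q' (n : nat) : R :=
  \sum_(s : 'S_(2 * n) | Dperm s)
    ((\prod_(i in Cval s) a (lcross' s i) (lnest' s i)) *
     (\prod_(i in Cpeak s) b (ucross' s i) (unest' s i)) *
     (\prod_(i in Cdfall s) c (lcross' s i) (lnest' s i)) *
     (\prod_(i in Cdrise s) d (ucross' s i) (unest' s i)) *
     (\prod_(i in Evenfix s) e (psnest s i)) *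
     (\prod_(i in Oddfix s) f (psnest s i))).

Definition Q (n : nat) : R :=
  \sum_(s : 'S_(2 * n) | Dperm s)
    ((\prod_(i in Cval s) a (ucross s i) (unest s i)) *
     (\prod_(i in Cpeak s) b (lcross s i) (lnest s i)) *
     (\prod_(i in Cdfall s) c (lcross s i) (lnest s i)) *
     (\prod_(i in Cdrise s) d (ucross s i) (unest s i)) *
     (\prod_(i in Evenfix s) e (psnest s i)) *
     (\prod_(i in Oddfix s) f (psnest s i))).

End MasterPolynomials.

(* A formal power series over R is its sequence of coefficients nat -> R.     *)
Section PowerSeries.

Variable R : comNzRingType.
Implicit Types (u g F : nat -> R) (alpha delta : nat -> R).

Definition ps_one : nat -> R := fun n => (n == 0%N)%:R.

Definition ps_mul u g : nat -> R :=
  fun n => \sum_(i < n.+1) u i * g (n - i)%N.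

Definition ps_exp u (p : nat) : nat -> R := iter p (ps_mul u) ps_one.

(* 1 / (1 - u) = \sum_p u^p, for u with zero constant term: then u^p has no   *)
(* term of degree n < p, so the coefficient of t^n only involves p <= n.      *)
Definition ps_inv1B u : nat -> R :=
  fun n => \sum_(p < n.+1) ps_exp u p n.

Lemma ps_exp_lt u p n : u 0%N = 0 -> (n < p)%N -> ps_exp u p n = 0.
Proof.
move=> u0; elim: p n => // p IHp n ltnp.
rewrite /ps_exp iterS /ps_mul big1 // => -[[|i] /= ltin] _.
  by rewrite u0 mul0r.
by rewrite -/(ps_exp u p) IHp ?mulr0 // subnS; case: n ltnp ltin => // n *;
   rewrite subSn //= (leq_ltn_trans (leq_subr _ _)).
Qed.

Lemma ps_inv1BP u :
  u 0%N = 0 -> ps_mul (fun n => ps_one n - u n) (ps_inv1B u) =1 ps_one.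
Proof.
move=> u0 n.
have invE k : (k <= n)%N -> ps_inv1B u k = \sum_(p < n.+1) ps_exp u p k.
  move=> lekn; rewrite /ps_inv1B (big_ord_widen n.+1 (fun p => ps_exp u p k)) //.
  rewrite big_mkcond; apply: eq_bigr => p _; case: ltnP => // ltkp.
  by rewrite ps_exp_lt.
have oneE g : ps_mul ps_one g n = g n.
  rewrite /ps_mul big_ord_recl subn0 mul1r big1 ?addr0 // => i _.
  by rewrite mul0r.
transitivity (\sum_(p < n.+1) (ps_exp u p n - ps_exp u p.+1 n)).
  under [LHS]eq_bigr => i _ do rewrite invE ?leq_subr // mulr_sumr.
  rewrite exchange_big; apply: eq_bigr => p _ /=.
  under eq_bigr => i _ do rewrite mulrBl.
  by rewrite sumrB -[X in X - _]/(ps_mul ps_one (ps_exp u p) n) oneE.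
rewrite -(big_mkord xpredT (fun p => ps_exp u p n - ps_exp u p.+1 n)).
rewrite -[LHS]opprK -sumrN; under eq_bigr => i _ do rewrite opprB.
by rewrite telescope_sumr // [X in X - _]ps_exp_lt // sub0r opprK.
Qed.

(* t * (x + y * g) *)
Definition ps_tail (x y : R) g : nat -> R :=
  fun n => if n is n'.+1 then x * ps_one n' + y * g n' else 0.

(* The truncation                                                             *)
(*   1/(1 - delta_k t - alpha_k t/( ... /(1 - delta_(k+N-1) t)))              *)
(* at depth N of the T-fraction starting with the coefficients of index k.    *)
Fixpoint tfrac_trunc alpha delta (k N : nat) : nat -> R :=
  if N is N'.+1 then
    ps_inv1B (ps_tail (delta k) (alpha k) (tfrac_trunc alpha delta k.+1 N'))
  else fun=> 0.

(* F = 1/(1 - delta_1 t - alpha_1 t/(1 - delta_2 t - alpha_2 t/(1 - ... ))),  *)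
(* the infinite fraction being the limit of its truncations in the topology   *)
(* of formal power series; alpha_0 and delta_0 do not occur.                  *)
Definition is_tfrac alpha delta F : Prop :=
  forall n, exists N0, forall N, (N0 <= N)%N -> tfrac_trunc alpha delta 1 N n = F n.

End PowerSeries.

(* Main.v *)
(* A permutation in D_2n has its excedances at odd positions and its           *)
(* anti-excedances at even ones, so it is the union of an increasing and a     *)
(* decreasing half-matching, glued along fixed points. Recording at each       *)
(* position whether it is a cycle valley or peak, a cycle double rise or fall, *)
(* or a fixed point determines the four endpoint sets of the halves, hence     *)
(* psnest, and the two halves can then be chosen independently. Each half is   *)
(* summed greedily: a position that sees h available partners contributes      *)
(* \sum_(xi < h) w (h - 1 - xi) xi, one term per rank of the partner chosen.   *)
(* What remains is a sum over weighted lattice paths, given by the continued   *)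
(* fraction. In Q the greedy choices are made along s, in Q' along s^-1, and   *)
(* the heights seen at each position are the same.                             *)
Require Import Defs.
From HB Require Import structures.
From mathcomp Require Import all_boot all_order all_algebra all_fingroup.
From mathcomp Require Import zify ring.

Set Implicit Arguments.
Unset Strict Implicit.
Unset Printing Implicit Defensive.

Import GRing.Theory.
Local Open Scope ring_scope.

(** * Power series and T-fractions *)

(** Draw excedances as upper arcs and anti-excedances as lower arcs. Positions are 0-based, so cycle
    valleys ([rises]) sit at even positions and cycle peaks ([falls]) at odd ones; the height, rises
    minus falls so far, counts the open upper arcs and equally the open lower arcs.

    A word of kinds is the same data as the four sets of arc endpoints ([has_word_support]). For
    fixed endpoints the upper and lower arcs are independent ([sum_has_support]), and each family
    sums to a product of [level_sum] factors ([sum_matchings]). Arcs read from [s] or from its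
    inverse meet the same heights, so [sum_word_Q] and [sum_word_Q'] both give [word_weight], hence
    the equality of the two polynomials.

    Summing over words ([sum_by_words]) leaves paths that rise or stay level at even positions and
    fall or stay level at odd ones. Replacing the height h after k letters by 2h, minus one if k is
    odd, makes every step +1 or -1. The only excursions below 0 are pairs of fixed points with
    weight [e 0 * f 0], which is [delta 1]. Decomposing by the last step gives the continued
    fraction ([is_tfrac_heights], [is_tfrac_path_sum]). *)

Section ContinuedFraction.

Variable R : comNzRingType.
Implicit Types u v g z : nat -> R.

Lemma eq_ps_mul u1 u2 g1 g2 n :
  (forall i, (i <= n)%N -> u1 i = u2 i) -> (forall i, (i <= n)%N -> g1 i = g2 i) ->
  ps_mul u1 g1 n = ps_mul u2 g2 n.
Proof.
move=> equ eqg; apply: eq_bigr => i _.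
by rewrite equ ?eqg ?leq_subr // -ltnS.
Qed.

(** Low coefficients only see truncations, so ring laws carry over from polynomials. *)
Lemma ps_mul_polyE u g N n : (n < N)%N ->
  ps_mul u g n = (\poly_(i < N) u i * \poly_(i < N) g i)`_n.
Proof.
move=> ltnN; rewrite coefM; apply: eq_bigr => i _; rewrite !coef_poly.
have -> : (i < N)%N by apply: leq_trans ltnN; apply: ltn_ord.
by rewrite (leq_ltn_trans (leq_subr _ _) ltnN).
Qed.

Lemma ps_mulC u g n : ps_mul u g n = ps_mul g u n.
Proof. by rewrite !(ps_mul_polyE _ _ (ltnSn n)) mulrC. Qed.

Lemma ps_mulA u g z n : ps_mul u (ps_mul g z) n = ps_mul (ps_mul u g) z n.
Proof.
pose P v := \poly_(i < n.+1) v i.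
have PM v1 v2 i : (i < n.+1)%N -> (P (ps_mul v1 v2))`_i = (P v1 * P v2)`_i.
  by move=> ltin; rewrite coef_poly ltin -ps_mul_polyE.
rewrite !(ps_mul_polyE _ _ (ltnSn n)) -!/(P _).
transitivity ((P u * (P g * P z))`_n); last first.
  by rewrite mulrA !coefM; apply: eq_bigr => i _; rewrite PM ?ltn_ord.
by rewrite !coefM; apply: eq_bigr => i _; rewrite PM // ltnS leq_subr.
Qed.

Lemma ps_mul1 g n : ps_mul (@ps_one R) g n = g n.
Proof.
rewrite /ps_mul big_ord_recl subn0 mul1r big1 ?addr0 // => i _.
by rewrite mul0r.
Qed.

Lemma ps_mul_tailS x y g z n :
  ps_mul (ps_tail x y g) z n.+1 = x * z n + y * ps_mul g z n.
Proof.
rewrite /ps_mul big_ord_recl mul0r add0r.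
under eq_bigr => i _ do rewrite mulrDl -!mulrA subSS.
by rewrite big_split /= -!mulr_sumr -/(ps_mul _ _ _) ps_mul1.
Qed.

Lemma ps_inv1B_mulP v g n : v 0%N = 0 ->
  ps_mul (ps_inv1B v) g n = g n + ps_mul v (ps_mul (ps_inv1B v) g) n.
Proof.
move=> v0; apply/eqP; rewrite -subr_eq; apply/eqP.
rewrite -[LHS]/(_ - _) -{1}[ps_mul _ g n]ps_mul1 /ps_mul -sumrB.
under eq_bigr => i _ do rewrite -mulrBl.
rewrite -/(ps_mul (fun i => ps_one R i - v i) (ps_mul (ps_inv1B v) g) n) ps_mulA.
by rewrite (eq_ps_mul (u2 := @ps_one R) (g2 := g)) ?ps_mul1 // => i _; rewrite ps_inv1BP.
Qed.

(** As [v] has no constant term, the equation z = g + v z determines the coefficients of z one after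
    the other; [ps_inv1B v] times [g] solves it. *)
Lemma ps_fixpointE N v g z : v 0%N = 0 ->
  (forall n, (n < N)%N -> z n = g n + ps_mul v z n) ->
  forall n, (n < N)%N -> z n = ps_mul (ps_inv1B v) g n.
Proof.
move=> v0 zE n; elim/ltn_ind: n => n IHn ltnN.
rewrite zE // ps_inv1B_mulP // /ps_mul; congr (_ + _).
rewrite !big_ord_recl v0 !mul0r; congr (_ + _); apply: eq_bigr => i _.
have ltn : (n - bump 0 i < n)%N by rewrite /bump /=; have := ltn_ord i; lia.
by rewrite IHn // (ltn_trans ltn).
Qed.

(* [y H] plays the role of the generating function of the weighted paths from  *)
(* height 0 to height H; up to the factor [rise H], the ratio of [y H.+1] and  *)
(* [y H] is the tail of the continued fraction that starts at index H + 2.     *)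
Lemma is_tfrac_heights (rise fall alpha delta : nat -> R) (y : nat -> nat -> R) :
  (forall H, alpha H.+1 = rise H * fall H.+1) ->
  (forall H, delta H.+2 = 0) ->
  (forall j, y 0%N j =
     if j is j'.+1 then delta 1%N * y 0%N j' + fall 1%N * y 1%N j' else 1) ->
  (forall H j, y H.+1 j =
     rise H * y H j + (if j is j'.+1 then fall H.+2 * y H.+2 j' else 0)) ->
  is_tfrac alpha delta (y 0%N).
Proof.
move=> alphaE delta0 y0E ySE.
(* Induction on the precision [N], for all [H] at once: the tail at [H.+3] is needed only to
   precision [N], since it enters multiplied by t. *)
have yS N : forall H n, (n < N)%N ->
    y H.+1 n = rise H * ps_mul (tfrac_trunc alpha delta H.+2 N) (y H) n.
  elim: N => // N IHN H n ltnN.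
  rewrite (@ps_fixpointE N.+1 (ps_tail (delta H.+2) (alpha H.+2)
    (tfrac_trunc alpha delta H.+3 N)) (fun n => rise H * y H n)) //.
    by rewrite /= /ps_mul mulr_sumr; apply: eq_bigr => i _; rewrite mulrCA.
  case=> [|k] ltkN; rewrite ySE.
    by rewrite /ps_mul big_ord1 mul0r.
  by rewrite ps_mul_tailS delta0 alphaE IHN // mul0r add0r mulrCA mulrA.
move=> n; exists n.+1 => -[//|N] ltnN /=.
rewrite (@ps_fixpointE N.+1 (ps_tail (delta 1%N) (alpha 1%N)
  (tfrac_trunc alpha delta 2 N)) (@ps_one R) (y 0%N)) //.
  by rewrite ps_mulC ps_mul1.
case=> [|k] ltkN; rewrite y0E.
  by rewrite /ps_mul big_ord1 mul0r addr0.
by rewrite ps_mul_tailS alphaE (yS N) // add0r mulrCA mulrA.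
Qed.

End ContinuedFraction.

(** * Half-matchings *)

(** Total weight of choosing one of [h] candidates, weighted by the numbers of candidates on its two
    sides; it vanishes for [h = 0]. *)
Definition level_sum (R : nmodType) (g : nat -> nat -> R) (h : nat) : R :=
  \sum_(0 <= xi < h) g (h - 1 - xi)%N xi.

Section HalfMatchings.

(* The key allows both orders on ordinals: increasing matchings are decreasing *)
(* ones for the reversed order. Outside its domain a matching is the identity. *)
Variables (T : finType) (key : T -> nat).
Hypothesis key_inj : injective key.

Definition below (A : {set T}) (y : T) : nat := #|[set z in A | (key z < key y)%N]|.

Definition matching (V P : {set T}) (u : {ffun T -> T}) : bool :=
  [forall y, if y \in V then (key (u y) < key y)%N else u y == y] && (u @: V == P).

Definition cross (u : T -> T) (y : T) : nat :=
  #|[set z | (key y < key z)%N && (key (u y) < key (u z) < key y)%N]|.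

Definition nest (u : T -> T) (y : T) : nat :=
  #|[set z | (key y < key z)%N && (key (u z) < key (u y))%N]|.

(** Remove the largest element: it contributes the last term, and for every other element the first
    count drops by one. *)
Lemma sum_by_rank (R : nmodType) (g : nat -> nat -> R) (A : {set T}) :
  \sum_(p in A) g #|[set q in A | (key p < key q)%N]| (below A p) = level_sum g #|A|.
Proof.
move def_n: #|A| => n; elim: n => [|n IHn] in g A def_n *.
  by rewrite (cards0_eq def_n) /level_sum big_geq // big_set0.
have /card_gt0P [x0 Ax0] : (0 < #|A|)%N by rewrite def_n.
have [M AM' /= maxM'] := arg_maxnP key Ax0.
have AM : M \in A := AM'.
have maxM q : q \in A -> (key q <= key M)%N := maxM' q.
have ltM q : q \in A -> q != M -> (key q < key M)%N.
  by move=> Aq neq; rewrite ltn_neqAle (inj_eq key_inj) neq maxM.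
have cardAM : #|A :\ M| = n by move: def_n; rewrite (cardsD1 M) AM => -[].
rewrite (big_setD1 M) //= /level_sum big_nat_recr //= addrC; congr (_ + _); last first.
  congr (g _ _).
    rewrite !(subSS, subn0) subnn; apply/eqP; rewrite cards_eq0; apply/eqP/setP=> q.
    by rewrite !inE; apply/negP => /andP[/maxM]; rewrite leqNgt => /negbTE->.
  rewrite -cardAM /below; apply: eq_card => q; rewrite !inE andbC.
  by case: eqVneq => [->|neq] /=; [rewrite ltnn | case: (boolP (q \in A)) => Aq;
    rewrite ?andbF // ltM].
have := IHn (fun x y => g x.+1 y) (A :\ M) cardAM; rewrite /level_sum.
under [in X in _ = X -> _]eq_big_nat => i ltin do rewrite subnAC subn1 prednK ?subn_gt0 //.
move=> IH; under [RHS]eq_big_nat => i ltin do rewrite subSS subn0.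
rewrite -IH; apply: eq_bigr => p; rewrite !inE => /andP[neq Ap]; congr (g _ _).
  rewrite (cardsD1 M) inE AM ltM //; congr (_.+1).
  by apply: eq_card => q; rewrite !inE andbA.
apply: eq_card => q; rewrite !inE; case: eqVneq => [->|//].
by rewrite AM /= ltnNge ltnW // ltM.
Qed.

Lemma matchingP (V P : {set T}) (u : {ffun T -> T}) :
  reflect [/\ forall y, y \in V -> (key (u y) < key y)%N,
              forall y, y \notin V -> u y = y & u @: V = P]
          (matching V P u).
Proof.
apply: (iffP andP) => [[/forallP uP /eqP uVP]|[uV uN uVP]].
  split=> // y Vy.
  - by have := uP y; rewrite Vy.
  - by have := uP y; rewrite (negPf Vy) => /eqP.
split; last by apply/eqP.
by apply/forallP => y; case: ifPn => [/uV|/uN ->].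
Qed.

Lemma matching_inj (V P : {set T}) (u : {ffun T -> T}) :
  #|V| = #|P| -> matching V P u -> {in V &, injective u}.
Proof. by move=> cVP /matchingP[_ _ uVP]; apply/imset_injP; rewrite uVP cVP. Qed.

Definition reset (v p : T) (u : {ffun T -> T}) : {ffun T -> T} :=
  [ffun y => if y == v then p else u y].

(** Deleting the pair from [v] to [p] is a bijection onto the matchings of the remaining points; the
    left side has the shape that [reindex_onto] produces. *)
Lemma matching_reset (V P : {set T}) (v p : T) (u : {ffun T -> T}) :
  #|V| = #|P| -> v \in V -> p \in P -> (key p < key v)%N ->
  matching V P (reset v p u) && (reset v p u v == p) &&
    (reset v v (reset v p u) == u) =
  matching (V :\ v) (P :\ p) u.
Proof.
move=> cVP Vv Pp ltpv.
have rv : reset v p u v = p by rewrite ffunE eqxx.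
have rE y : y != v -> reset v p u y = u y by rewrite ffunE => /negPf->.
have -> : (reset v v (reset v p u) == u) = (u v == v).
  apply/eqP/eqP => [/ffunP/(_ v)|uv]; first by rewrite !ffunE eqxx.
  by apply/ffunP => y; rewrite !ffunE; case: eqVneq => // ->.
rewrite rv eqxx !andbT.
apply/andP/idP => [[mu /eqP uv]|/matchingP[uV uN uVP]].
  have inju := matching_inj cVP mu; have [uV uN uVP] := matchingP _ _ _ mu.
  apply/matchingP; split=> [y|y|].
  - by rewrite !inE => /andP[nyv /uV]; rewrite rE.
  - rewrite !inE negb_and negbK; case: eqVneq => [-> //|nyv /= /uN].
    by rewrite rE.
  apply/setP=> q; rewrite !inE -uVP; apply/imsetP/andP => [[y]|[nqp /imsetP[y Vy eqy]]].
    rewrite !inE => /andP[nyv Vy ->]; rewrite -rE //; split; last exact: imset_f.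
    by rewrite -[X in _ == X]rv (inj_in_eq inju).
  have nyv : y != v by apply: contraNneq nqp => eyv; rewrite eqy eyv rv.
  by exists y; rewrite ?inE ?nyv // eqy rE.
have uv : u v = v by rewrite uN // !inE eqxx.
rewrite uv; split=> //; apply/matchingP; split=> [y Vy|y nVy|].
- by have [->|nyv] := eqVneq y v; rewrite ?rv // rE ?uV // !inE nyv.
- have nyv : y != v by apply: contraNneq nVy => ->.
  by rewrite rE // uN // !inE negb_and nVy orbT.
rewrite -(setD1K Vv) imsetU1 rv -(setD1K Pp) -uVP; congr (_ |: _).
by apply: eq_in_imset => y; rewrite !inE => /andP[nyv _]; rewrite rE.
Qed.

(* Process the elements of [V] in increasing order: the image of the least one *)
(* can be any element of [P] below it, and the crossings and nestings at the   *)
(* other elements do not depend on that choice.                                *)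
Lemma sum_matchings (R : comNzRingType) (w : T -> nat -> nat -> R) (V P : {set T}) :
  #|V| = #|P| ->
  \sum_(u | matching V P u) \prod_(y in V) w y (cross u y) (nest u y) =
  \prod_(y in V) level_sum (w y) (below P y - below V y).
Proof.
move def_n: #|V| => n; elim: n => [|n IHn] in V P def_n * => cVP.
  rewrite (cards0_eq def_n) (cards0_eq (esym cVP)).
  rewrite big_set0 (big_pred1 [ffun y => y]) ?big_set0 // => u.
  apply/matchingP/eqP => [[_ uN _]|->].
    by apply/ffunP => y; rewrite ffunE uN ?inE.
  by split=> [y|y|]; rewrite ?inE ?imset0 ?ffunE.
have cVP' : #|V| = #|P| by rewrite def_n.
have /card_gt0P [x0 Vx0] : (0 < #|V|)%N by rewrite def_n.
have [v Vv' /= minv'] := arg_minnP key Vx0.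
have Vv : v \in V := Vv'.
have minv y : y \in V -> (key v <= key y)%N := minv' y.
have ltv y : y \in V :\ v -> (key v < key y)%N.
  by rewrite !inE => /andP[neq Vy]; rewrite ltn_neqAle (inj_eq key_inj) eq_sym neq minv.
rewrite [RHS](big_setD1 v) //=.
(* No element of [V] precedes [v], so every point of [P] below [v] is still available. *)
have -> : (below P v - below V v = #|[set q in P | (key q < key v)%N]|)%N.
  rewrite /below [in X in (_ - X)%N](_ : [set z in V | _] = set0) ?cards0 ?subn0 //.
  by apply/setP=> z; rewrite !inE; apply/negP=> /andP[/minv]; rewrite leqNgt => /negbTE->.
rewrite -sum_by_rank mulr_suml.
rewrite (partition_big (fun u : {ffun T -> T} => u v)
           (mem [set q in P | (key q < key v)%N])) /=; last first.
  move=> u /matchingP[uV _ uVP]; rewrite !inE uV // andbT -uVP.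
  exact: imset_f.
apply: eq_bigr => p; rewrite inE => /andP[Pp ltpv].
rewrite (reindex_onto (reset v p) (reset v v)) /=; last first.
  move=> u /andP[_ /eqP uvp]; apply/ffunP => y; rewrite !ffunE.
  by case: eqVneq => // ->.
rewrite (eq_bigl _ _ (fun u => matching_reset u cVP' Vv Pp ltpv)).
have cV' : #|V :\ v| = n by move: def_n; rewrite (cardsD1 v) Vv => -[].
have cP' : n = #|P :\ p| by move: cVP; rewrite (cardsD1 p) Pp => -[].
have below1 (A : {set T}) z y : z \in A -> (key z < key y)%N ->
    below A y = (below (A :\ z) y).+1.
  move=> Az ltzy; rewrite /below (cardsD1 z) inE Az ltzy; congr (_.+1).
  by apply: eq_card => q; rewrite !inE andbA.
(* Both [p] and [v] lie below [y]: deleting them lowers both counts by one and keeps their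
   difference. *)
under [X in _ = _ * X]eq_bigr => y Vy.
  rewrite (below1 P p) ?(below1 V v) ?subSS ?ltv ?(ltn_trans ltpv) ?ltv //.
  over.
rewrite -(IHn _ _ cV' cP') mulr_sumr.
apply: eq_bigr => u mu; rewrite (big_setD1 v) //=; congr (_ * _).
  have [uV uN uVP] := matchingP _ _ _ mu.
  have inju : {in V :\ v &, injective u} by apply: (matching_inj _ mu); rewrite cV'.
  have rE y : (key v < key y)%N -> reset v p u y = u y.
    by rewrite ffunE; case: eqP => // ->; rewrite ltnn.
  have rv : reset v p u v = p by rewrite ffunE eqxx.
  (* [u] is a bijection from [V :\ v] to [P :\ p], so the arcs crossing or nesting with the one at
     [v] can be counted by their values. *)
  have cardu (B : pred T) :
      #|[set z in V :\ v | B (u z)]| = #|[set q in P :\ p | B q]|.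
    rewrite -(card_in_imset (f := u)); last first.
      by move=> y z; rewrite !inE => /andP[Vy _] /andP[Vz _]; apply: inju; rewrite !inE.
    apply: eq_card => q; rewrite [in RHS]inE -uVP.
    apply/imsetP/andP => [[z]|[/imsetP[z Vz ->] Bz]].
      by rewrite inE => /andP[Vz Bz] ->; split=> //; apply: imset_f.
    by exists z => //; rewrite inE Vz.
  have inV z : (key v < key z)%N -> (key (u z) < key v)%N -> z \in V :\ v.
    move=> ltvz ltuz; apply: contraLR ltuz => nVz.
    by rewrite uN // -leqNgt ltnW.
  congr (w v _ _).
    rewrite [RHS](_ : _ = #|[set q in P :\ p | (key p < key q < key v)%N]|); last first.
      apply: eq_card => q; rewrite !inE.
      case: eqVneq => [->|_] /=; first by rewrite ltnn andbF.
      by rewrite -andbA; congr (_ && _); rewrite andbC.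
    rewrite -(cardu (fun q => (key p < key q < key v)%N)).
    apply: eq_card => z; rewrite [in LHS]inE [in RHS]inE rv.
    apply/andP/andP => [[ltvz]|[Vz]]; [rewrite rE // | by rewrite rE ltv].
    by case/andP=> ltpu ltuv; split; [apply: inV | rewrite ltpu].
  rewrite [RHS](_ : _ = #|[set q in P :\ p | (key q < key p)%N]|); last first.
    rewrite /below; apply: eq_card => q; rewrite !inE.
    case: eqVneq => [->|_] /=; first by rewrite ltnn andbF.
    by rewrite -andbA; congr (_ && _); rewrite andb_idl // => /ltn_trans; apply.
  rewrite -(cardu (fun q => (key q < key p)%N)).
  apply: eq_card => z; rewrite [in LHS]inE [in RHS]inE rv.
  apply/andP/andP => [[ltvz]|[Vz]]; [rewrite rE // => ltup | by rewrite rE ltv].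
  by split=> //; apply: inV ltvz (ltn_trans ltup ltpv).
apply: eq_bigr => y Vy.
have rE z : (key y <= key z)%N -> reset v p u z = u z.
  move=> leyz; rewrite ffunE; case: eqP leyz => // ->.
  by rewrite leqNgt ltv.
congr (w y _ _); apply: eq_card => z; rewrite !inE (rE y) //;
  by case: (ltnP (key y) (key z)) => [ltyz|//]; rewrite rE // ltnW.
Qed.

End HalfMatchings.

(** * Splitting permutations into half-matchings *)

Section PermutationHalves.

Variable m : nat.
Implicit Types (r s : 'S_m) (X Y : {set 'I_m}).

Definition exc s : {set 'I_m} := [set i : 'I_m | (i < s i)%N].
Definition aexc s : {set 'I_m} := [set i : 'I_m | (s i < i)%N].

(** [X'] and [Y'] are the images under [r] of [X] and [Y], by [aexcV] and [excV]. *)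
Definition has_support X Y X' Y' r : bool :=
  [&& exc r == X, aexc r == Y, aexc r^-1%g == X' & exc r^-1%g == Y'].

Definition up_key (i : 'I_m) : nat := i.
Definition down_key (i : 'I_m) : nat := (m - i)%N.

Lemma up_key_inj : injective up_key.
Proof. exact: val_inj. Qed.

Lemma ltn_down_key i j : (down_key i < down_key j)%N = (j < i)%N.
Proof. by rewrite /down_key; have := ltn_ord i; have := ltn_ord j; lia. Qed.

Lemma down_key_inj : injective down_key.
Proof.
by move=> i j; rewrite /down_key => eqij; apply: val_inj;
   have := ltn_ord i; have := ltn_ord j; move: eqij => /=; lia.
Qed.

Definition restr X r : {ffun 'I_m -> 'I_m} := [ffun x => if x \in X then r x else x].

Lemma aexcV r : aexc r^-1%g = r @: exc r.
Proof.
apply/setP=> y; apply/idP/imsetP => [|[x ltx ->]].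
  by rewrite inE => lty; exists (r^-1%g y); rewrite ?inE permKV.
by rewrite !inE permK in ltx *.
Qed.

Lemma excV r : exc r^-1%g = r @: aexc r.
Proof.
apply/setP=> y; apply/idP/imsetP => [|[x ltx ->]].
  by rewrite inE => lty; exists (r^-1%g y); rewrite ?inE permKV.
by rewrite !inE permK in ltx *.
Qed.

Lemma card_aexcV r : #|aexc r^-1%g| = #|exc r|.
Proof. by rewrite aexcV card_imset //; apply: perm_inj. Qed.

Lemma fixed_notin_exc r x : x \notin exc r -> x \notin aexc r -> r x = x.
Proof.
by rewrite !inE -!leqNgt => lerx lexr; apply: val_inj; apply/eqP; rewrite eqn_leq lerx.
Qed.

(** A permutation is recovered by fusing its restrictions to excedances and anti-excedances.
    Conversely, two half-matchings fuse to a permutation because their images are disjoint and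
    together cover exactly the moved points. *)
Lemma sum_has_support (R : comNzRingType) X Y X' Y'
    (F G : {ffun 'I_m -> 'I_m} -> R) :
  [disjoint X & Y] -> [disjoint X' & Y'] -> X :|: Y = X' :|: Y' ->
  #|X| = #|X'| -> #|Y| = #|Y'| ->
  \sum_(r | has_support X Y X' Y' r) F (restr X r) * G (restr Y r) =
  (\sum_(u | matching down_key X X' u) F u) * (\sum_(u | matching up_key Y Y' u) G u).
Proof.
move=> dXY dXY' eqU cX cY.
pose fuse (p : {ffun 'I_m -> 'I_m} * {ffun 'I_m -> 'I_m}) :=
  [ffun x => if x \in X then p.1 x else p.2 x].
pose perm_fuse p : 'S_m := insubd (1%g : 'S_m) (fuse p).
have perm_fuseE p : injectiveb (fuse p) -> perm_fuse p =1 fuse p.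
  by move=> injf x; rewrite -pvalE -[pval _]/(val _) insubdK.
rewrite big_distrlr /= pair_big /=.
rewrite (reindex_onto (fun r => (restr X r, restr Y r)) perm_fuse).
  apply: eq_bigl => r.
  have fE x : fuse (restr X r, restr Y r) x = if (x \in X) || (x \in Y) then r x else x.
    by rewrite !ffunE /=; case: (x \in X).
  have -> : perm_fuse (restr X r, restr Y r) == r =
            [forall x, (x \notin X) ==> (x \notin Y) ==> (r x == x)].
    apply/eqP/forallP => [eqr x|fixr].
      apply/implyP => /negPf nXx; apply/implyP => /negPf nYx.
      have [injf|ninjf] := boolP (injectiveb (fuse (restr X r, restr Y r))).
        by have /permP/(_ x) := eqr; rewrite perm_fuseE // fE nXx nYx => /esym/eqP.
      (* A non-injective fusion gives the default [1]; then [r] is the identity and fixes [x]. *)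
      by rewrite -eqr /perm_fuse /insubd insubN // perm1.
    have fr : fuse (restr X r, restr Y r) =1 r.
      move=> x; rewrite fE; case: ifPn => //; rewrite negb_or => /andP[nXx nYx].
      by have := fixr x; rewrite nXx nYx => /eqP.
    apply/permP => x; rewrite perm_fuseE ?fr //.
    by apply/injectiveP => y z; rewrite !fr; apply: perm_inj.
  have imr (A : {set 'I_m}) : restr A r @: A = r @: A.
    by apply: eq_in_imset => x Ax; rewrite ffunE Ax.
  apply/and4P/idP => [[/eqP eX /eqP eY /eqP eX' /eqP eY']|].
    rewrite -andbA; apply/and3P; split.
    - apply/matchingP; rewrite imr -eX' aexcV eX; split=> // x; rewrite ffunE.
        by move=> Xx; rewrite Xx ltn_down_key; move: Xx; rewrite -eX inE.
      by move/negPf->.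
    - apply/matchingP; rewrite imr -eY' excV eY; split=> // x; rewrite ffunE.
        by move=> Yx; rewrite Yx; move: Yx; rewrite -eY inE.
      by move/negPf->.
    apply/forallP => x; apply/implyP => nX; apply/implyP => nY; apply/eqP.
    by apply: fixed_notin_exc; rewrite ?eX ?eY.
  case/andP=> /andP[/matchingP[rX _ rXX] /matchingP[rY _ rYY] /forallP fixr].
  have {}rX x : x \in X -> (x < r x)%N.
    by move=> Xx; have := rX x Xx; rewrite ffunE Xx ltn_down_key.
  have {}rY x : x \in Y -> (r x < x)%N.
    by move=> Yx; have := rY x Yx; rewrite ffunE Yx.
  have eX : exc r = X.
    apply/setP=> x; rewrite inE; apply/idP/idP => [|/rX //].
    apply: contraTT => nX; have [/rY|nY] := boolP (x \in Y).
      by move/ltnW; rewrite leqNgt.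
    by have := fixr x; rewrite nX nY => /eqP ->; rewrite ltnn.
  have eY : aexc r = Y.
    apply/setP=> x; rewrite inE; apply/idP/idP => [|/rY //].
    apply: contraTT => nY; have [/rX|nX] := boolP (x \in X).
      by move/ltnW; rewrite leqNgt.
    by have := fixr x; rewrite nX nY => /eqP ->; rewrite ltnn.
  by rewrite aexcV excV eX eY -rXX -rYY !imr.
move=> [u n] /= /andP[mu mn].
have [uX uN uXX] := matchingP _ _ _ _ mu; have [nY nN nYY] := matchingP _ _ _ _ mn.
have fX x : x \in X -> fuse (u, n) x = u x /\ u x \in X'.
  by move=> Xx; rewrite ffunE Xx -uXX imset_f.
have fY x : x \in Y -> fuse (u, n) x = n x /\ n x \in Y'.
  by move=> Yx; rewrite ffunE (disjointFl dXY Yx) -nYY imset_f.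
have fN x : x \notin X -> x \notin Y -> fuse (u, n) x = x /\ (x \notin X' :|: Y').
  by move=> nX nnY; rewrite ffunE (negPf nX) /= nN // -eqU inE negb_or nX.
have inju := matching_inj cX mu; have injn := matching_inj cY mn.
have injf : injectiveb (fuse (u, n)).
  apply/injectiveP => x y.
  have [Xx|nXx] := boolP (x \in X); last have [Yx|nYx] := boolP (x \in Y);
  (have [Xy|nXy] := boolP (y \in X); last have [Yy|nYy] := boolP (y \in Y)).
  - by have [-> _] := fX x Xx; have [-> _] := fX y Xy; apply: inju.
  - have [-> Xu] := fX x Xx; have [-> Yn] := fY y Yy => equn.
    by rewrite equn (disjointFl dXY' Yn) in Xu.
  - have [-> Xu] := fX x Xx; have [-> nU] := fN y nXy nYy => equn.
    by rewrite -equn inE Xu in nU.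
  - have [-> Yn] := fY x Yx; have [-> Xu] := fX y Xy => equn.
    by rewrite -equn (disjointFl dXY' Yn) in Xu.
  - by have [-> _] := fY x Yx; have [-> _] := fY y Yy; apply: injn.
  - have [-> Yn] := fY x Yx; have [-> nU] := fN y nXy nYy => equn.
    by rewrite -equn inE Yn orbT in nU.
  - have [-> nU] := fN x nXx nYx; have [-> Xu] := fX y Xy => equn.
    by rewrite equn inE Xu in nU.
  - have [-> nU] := fN x nXx nYx; have [-> Yn] := fY y Yy => equn.
    by rewrite equn inE Yn orbT in nU.
  - by have [-> _] := fN x nXx nYx; have [-> _] := fN y nXy nYy.
congr (_, _); apply/ffunP => x; rewrite ffunE perm_fuseE // ffunE /=.
  by have [|/uN ->] := boolP (x \in X).
by have [Yx|/nN -> //] := boolP (x \in Y); rewrite (disjointFl dXY Yx).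
Qed.

(** Used to count the triples of a crossing or nesting by the one index that determines them. *)
Lemma card_parametrized (S S' : finType) (g : S -> S') (p : pred S') :
  injective g -> (forall t, p t -> exists l, t = g l) ->
  #|[set t | p t]| = #|[set l | p (g l)]|.
Proof.
move=> g_inj p_g; rewrite -(card_imset _ g_inj); apply: eq_card => t.
apply/idP/imsetP => [|[l]]; rewrite inE; last by move=> pgl ->; rewrite inE.
by move=> pt; have [l eqt] := p_g t pt; exists l; rewrite // inE -eqt.
Qed.

Lemma lcrossE r y :
  lcross r y = #|[set l : 'I_m | (y < l)%N && (r y < r l < y)%N]|.
Proof.
rewrite /lcross (card_parametrized (g := fun l => (r y, r l, l))); last 2 first.
- by move=> k l [].
- by move=> [[i j] l] /and3P[_ /eqP-> /eqP->]; exists l.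
by apply: eq_card => l; rewrite !inE /lt4 !eqxx !andbT andbA andbC.
Qed.

Lemma lnestE r y :
  lnest r y = #|[set l : 'I_m | (y < l)%N && (r l < r y < y)%N]|.
Proof.
rewrite /lnest (card_parametrized (g := fun l => (r l, r y, l))); last 2 first.
- by move=> k l [].
- by move=> [[i j] l] /and3P[_ /eqP-> /eqP->]; exists l.
by apply: eq_card => l; rewrite !inE /lt4 !eqxx !andbT andbA andbC.
Qed.

Lemma ucrossE r x :
  ucross r x = #|[set i : 'I_m | (i < x)%N && (x < r i < r x)%N]|.
Proof.
rewrite /ucross (card_parametrized (g := fun i => (i, r i, r x))); last 2 first.
- by move=> k l [].
- by move=> [[i k] l] /and3P[_ /eqP-> /eqP->]; exists i.
by apply: eq_card => l; rewrite !inE /lt4 !eqxx !andbT.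
Qed.

Lemma unestE r x :
  unest r x = #|[set i : 'I_m | (i < x)%N && (x < r x < r i)%N]|.
Proof.
rewrite /unest (card_parametrized (g := fun i => (i, r x, r i))); last 2 first.
- by move=> k l [].
- by move=> [[i k] l] /and3P[_ /eqP-> /eqP->]; exists i.
by apply: eq_card => l; rewrite !inE /lt4 !eqxx !andbT.
Qed.

(** An arc that crosses or nests with an upper arc in this sense is itself upper, and the points
    where the restriction is the identity never meet the inequalities. *)
Lemma ucross_restr r x : x \in exc r ->
  ucross r x = cross down_key (restr (exc r) r) x.
Proof.
move=> ex; rewrite ucrossE /cross; apply: eq_card => z; rewrite !inE !ffunE ex !inE.
rewrite inE in ex; case: (ltnP z (r z)) => lt_zr; rewrite ?ltn_down_key; lia.
Qed.

Lemma unest_restr r x : x \in exc r ->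
  unest r x = nest down_key (restr (exc r) r) x.
Proof.
move=> ex; rewrite unestE /nest; apply: eq_card => z; rewrite !inE !ffunE ex !inE.
rewrite inE in ex; case: (ltnP z (r z)) => lt_zr; rewrite ?ltn_down_key; lia.
Qed.

Lemma lcross_restr r x : x \in aexc r ->
  lcross r x = cross up_key (restr (aexc r) r) x.
Proof.
move=> ex; rewrite lcrossE /cross; apply: eq_card => z; rewrite !inE !ffunE ex !inE.
by rewrite inE in ex; rewrite /up_key; case: (ltnP (r z) z) => lt_zr; lia.
Qed.

Lemma lnest_restr r x : x \in aexc r ->
  lnest r x = nest up_key (restr (aexc r) r) x.
Proof.
move=> ex; rewrite lnestE /nest; apply: eq_card => z; rewrite !inE !ffunE ex !inE.
by rewrite inE in ex; rewrite /up_key; case: (ltnP (r z) z) => lt_zr; lia.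
Qed.

Lemma sum_cross_nest (R : comNzRingType) (wX wY : 'I_m -> nat -> nat -> R) X Y X' Y' :
  [disjoint X & Y] -> [disjoint X' & Y'] -> X :|: Y = X' :|: Y' ->
  #|X| = #|X'| -> #|Y| = #|Y'| ->
  \sum_(r | has_support X Y X' Y' r)
    (\prod_(x in X) wX x (ucross r x) (unest r x)) *
    (\prod_(y in Y) wY y (lcross r y) (lnest r y)) =
  (\prod_(x in X) level_sum (wX x) (below down_key X' x - below down_key X x)) *
  (\prod_(y in Y) level_sum (wY y) (below up_key Y' y - below up_key Y y)).
Proof.
move=> dXY dXY' eqU cX cY.
rewrite -(sum_matchings down_key_inj wX cX) -(sum_matchings up_key_inj wY cY).
rewrite -(sum_has_support _ _ dXY dXY' eqU cX cY).
apply: eq_bigr => r /and4P[/eqP<- /eqP<- _ _]; congr (_ * _); apply: eq_bigr => x ex.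
  by rewrite ucross_restr ?unest_restr.
by rewrite lcross_restr ?lnest_restr.
Qed.

Lemma eq_permV s x y : (x == s y) = (y == s^-1%g x).
Proof. by rewrite eq_sym (can2_eq (permK s) (permKV s)). Qed.

(** Inversion exchanges upper and lower arcs, and the primed statistics become the unprimed ones at
    the same position. *)
Lemma lcross'E s x : lcross' s x = ucross s^-1%g x.
Proof.
by apply: eq_card => -[[i j] k]; rewrite !inE; congr (_ && _);
   rewrite (eq_permV s) [in X in _ && X](eq_permV s) // andbC.
Qed.

Lemma lnest'E s x : lnest' s x = unest s^-1%g x.
Proof.
by apply: eq_card => -[[i j] k]; rewrite !inE; congr (_ && _);
   rewrite (eq_permV s) [in X in _ && X](eq_permV s) // andbC.
Qed.

Lemma ucross'E s x : ucross' s x = lcross s^-1%g x.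
Proof.
by apply: eq_card => -[[i j] k]; rewrite !inE; congr (_ && _);
   rewrite (eq_permV s) [in X in _ && X](eq_permV s) // andbC.
Qed.

Lemma unest'E s x : unest' s x = lnest s^-1%g x.
Proof.
by apply: eq_card => -[[i j] k]; rewrite !inE; congr (_ && _);
   rewrite (eq_permV s) [in X in _ && X](eq_permV s) // andbC.
Qed.

End PermutationHalves.

(** * Words of a permutation *)

Definition cnt (p : pred nat) (k : nat) : nat := \sum_(i < k) p i.

Lemma cntS p k : cnt p k.+1 = (cnt p k + p k)%N.
Proof. exact: big_ord_recr. Qed.

Lemma eq_cnt (p q : pred nat) k :
  (forall i, (i < k)%N -> p i = q i) -> cnt p k = cnt q k.
Proof. by move=> eqpq; apply: eq_bigr => i _; rewrite eqpq. Qed.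

Lemma cntD (p q r : pred nat) k :
  (forall i, r i = (p i + q i)%N :> nat) -> cnt r k = (cnt p k + cnt q k)%N.
Proof. by move=> eqr; rewrite /cnt -big_split; apply: eq_bigr => i _ /=. Qed.

Lemma leq_cnt p k l : (k <= l)%N -> (cnt p k <= cnt p l)%N.
Proof.
by move/subnKC <-; elim: (l - k)%N => [|j IHj]; rewrite ?addn0 // addnS cntS;
   apply: leq_trans IHj (leq_addr _ _).
Qed.

Lemma card_cnt m (p : pred nat) k : (k <= m)%N ->
  #|[set i : 'I_m | p i & (i < k)%N]| = cnt p k.
Proof.
move=> lekm; rewrite cardsE -sum1_card /cnt.
rewrite (big_ord_widen_cond m xpredT (fun i => nat_of_bool (p i))) //= [RHS]big_mkcond.
rewrite [LHS]big_mkcond; apply: eq_bigr => i _ /=.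
by rewrite unfold_in; case: (p i); case: (i < k)%N.
Qed.

Lemma card_set_cnt m (p : pred nat) : #|[set i : 'I_m | p i]| = cnt p m.
Proof.
by rewrite -(card_cnt p (leqnn m)); apply: eq_card => i; rewrite !inE ltn_ord andbT.
Qed.

Lemma below_up_key m (p : pred nat) (y : 'I_m) :
  below (@up_key m) [set i : 'I_m | p i] y = cnt p y.
Proof.
by rewrite -(card_cnt p (ltnW (ltn_ord y))); apply: eq_card => i; rewrite !inE.
Qed.

Lemma below_down_key m (p : pred nat) (y : 'I_m) :
  below (@down_key m) [set i : 'I_m | p i] y = (cnt p m - cnt p y.+1)%N.
Proof.
rewrite -(card_cnt p (ltn_ord y)) -(card_cnt p (leqnn m)) /below.
rewrite -(cardsID [set i : 'I_m | (i < y.+1)%N] [set i : 'I_m | p i & (i < m)%N]).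
have -> : [set i : 'I_m | p i & (i < m)%N] :&: [set i : 'I_m | (i < y.+1)%N] =
    [set i : 'I_m | p i & (i < y.+1)%N].
  by apply/setP=> i; rewrite !inE ltn_ord andbT.
rewrite addKn; apply: eq_card => i.
by rewrite !inE ltn_down_key ltn_ord andbT andbC -leqNgt.
Qed.

(* The parity of a position tells cycle valleys from cycle peaks ([turn]) and  *)
(* cycle double rises from cycle double falls ([through]).                     *)
Notation kind := (option bool).
Notation turn := (Some true).
Notation through := (Some false).
Notation fixpoint := None.

Definition kind_at m (s : 'S_m) (i : 'I_m) : kind :=
  if s i == i then fixpoint else Some ((i < s i)%N != ((s^-1)%g i < i)%N).

Section Words.

Variable tau : nat -> kind.

Definition rises : pred nat := fun i => ~~ odd i && (tau i == turn).
Definition falls : pred nat := fun i => odd i && (tau i == turn).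
Definition up_start : pred nat := fun i => ~~ odd i && (tau i != fixpoint).
(** An upper arc ends at a cycle peak (odd position, [turn]) or at a cycle double rise (even
    position, [through]). *)
Definition up_end : pred nat := fun i => tau i == Some (odd i).
Definition down_start : pred nat := fun i => odd i && (tau i != fixpoint).
Definition down_end : pred nat := fun i => tau i == Some (~~ odd i).

Definition has_word m (s : 'S_m) : bool := [forall i : 'I_m, kind_at s i == tau i].

(** Pointwise case analysis: parity and kind together fix on which sides of [i] its image and
    preimage lie. *)
Lemma has_word_support m (s : 'S_m) :
  Dperm s && has_word s =
  has_support [set i : 'I_m | up_start i] [set i : 'I_m | down_start i]
              [set i : 'I_m | up_end i] [set i : 'I_m | down_end i] s.
Proof.
have fixV i : (s i == i) = ((s^-1)%g i == i) by rewrite [LHS]eq_sym eq_permV eq_sym.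
have pointwise (i : 'I_m) :
    (if odd (label i) then (label i <= label (s i))%N else (label (s i) <= label i)%N) &&
      (kind_at s i == tau i) =
    [&& (i < s i)%N == up_start i, (s i < i)%N == down_start i,
        ((s^-1)%g i < i)%N == up_end i & (i < (s^-1)%g i)%N == down_end i].
  have := fixV i; rewrite /kind_at /label /= !ltnS.
  rewrite /up_start /down_start /up_end /down_end -!val_eqE /=.
  by case: (ltngtP (s i) i) => _; case: (ltngtP ((s^-1)%g i) i) => _ //= _;
     case: (odd i); case: (tau i) => [[]|].
apply/andP/and4P => [[/forallP sD /forallP sw]|[/eqP e1 /eqP e2 /eqP e3 /eqP e4]].
  have loc (i : 'I_m) : [&& (i < s i)%N == up_start i, (s i < i)%N == down_start i,
        ((s^-1)%g i < i)%N == up_end i & (i < (s^-1)%g i)%N == down_end i].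
    by rewrite -pointwise sD sw.
  by split; apply/eqP/setP=> i; rewrite !inE; have /and4P[/eqP ? /eqP ? /eqP ? /eqP ?] := loc i.
have loc (i : 'I_m) : [&& (i < s i)%N == up_start i, (s i < i)%N == down_start i,
      ((s^-1)%g i < i)%N == up_end i & (i < (s^-1)%g i)%N == down_end i].
  move/setP/(_ i): e1; move/setP/(_ i): e2; move/setP/(_ i): e3; move/setP/(_ i): e4.
  by rewrite !inE => -> -> -> ->; rewrite !eqxx.
by split; apply/forallP => i; have := loc i; rewrite -pointwise => /andP[].
Qed.

Let through_up : pred nat := fun i => ~~ odd i && (tau i == through).
Let through_down : pred nat := fun i => odd i && (tau i == through).

Lemma cnt_up_start k : cnt up_start k = (cnt rises k + cnt through_up k)%N.
Proof.
by apply: cntD => i; rewrite /up_start /rises /through_up; case: odd; case: (tau i) => [[]|].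
Qed.

Lemma cnt_up_end k : cnt up_end k = (cnt falls k + cnt through_up k)%N.
Proof.
by apply: cntD => i; rewrite /up_end /falls /through_up; case: odd; case: (tau i) => [[]|].
Qed.

Lemma cnt_down_start k : cnt down_start k = (cnt falls k + cnt through_down k)%N.
Proof.
by apply: cntD => i; rewrite /down_start /falls /through_down; case: odd; case: (tau i) => [[]|].
Qed.

Lemma cnt_down_end k : cnt down_end k = (cnt rises k + cnt through_down k)%N.
Proof.
by apply: cntD => i; rewrite /down_end /rises /through_down; case: odd; case: (tau i) => [[]|].
Qed.

Section FixedLength.

Variable m : nat.
Implicit Types s : 'S_m.

(** An upper arc starting before the fixed point [j] ends either before or after it; double rises
    both start and end an arc, so they cancel in the difference. *)
Lemma psnestE s j : Dperm s -> has_word s -> s j = j ->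
  psnest s j = (cnt rises j - cnt falls j)%N.
Proof.
move=> sD sw sjj; have := has_word_support s; rewrite sD sw => /esym.
case/and4P=> /eqP e1 _ /eqP e3 _.
suff : cnt up_start j = (psnest s j + cnt up_end j)%N.
  by rewrite cnt_up_start cnt_up_end; lia.
rewrite -!below_up_key -e1 -e3 /below /psnest.
rewrite -(cardsID [set i : 'I_m | (j < s i)%N] [set z in exc s | (up_key z < up_key j)%N]).
congr (_ + _)%N.
  apply: eq_card => i; rewrite !inE /up_key.
  by case: (ltnP i j) => //= ltij; case: (ltnP j (s i)) => ltj; rewrite ?andbF ?andbT //;
     rewrite (ltn_trans ltij).
rewrite -(card_imset _ (@perm_inj _ s)); apply: eq_card => v; rewrite inE aexcV.
apply/imsetP/andP => [[i]|[/imsetP[i ei ->]]].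
  rewrite !inE -leqNgt => /andP[lesj /andP[ei ltij]] ->; split.
    by apply: imset_f; rewrite inE.
  rewrite /up_key ltn_neqAle lesj andbT -[in X in _ != X]sjj.
  by rewrite (inj_eq val_inj) (inj_eq perm_inj) -(inj_eq val_inj) neq_ltn ltij.
rewrite inE in ei; rewrite /up_key => ltsj; exists i; rewrite // !inE -leqNgt ei /=.
by rewrite (ltnW ltsj) (ltn_trans ei).
Qed.

End FixedLength.

End Words.

(** * Sums over the permutations with a given word *)

(** Arguments are in the order of [a] to [f]. An odd position carries an even label, whence [E]
    there. *)
Definition by_kind (R : Type) (odd_pos : bool) (k : kind) (A B C D E F : R) : R :=
  if odd_pos then match k with turn => B | through => C | fixpoint => E end
  else match k with turn => A | through => D | fixpoint => F end.

Section KindProducts.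

Variables (R : comNzRingType) (m : nat) (tau : nat -> kind).
Variables A B C D E F : 'I_m -> R.

Let prod_by_kind : R :=
  \prod_(i < m) by_kind (odd i) (tau i) (A i) (B i) (C i) (D i) (E i) (F i).

Lemma prod_by_kindE (s : 'S_m) : Dperm s -> has_word tau s ->
  (\prod_(i in Cval s) A i) * (\prod_(i in Cpeak s) B i) * (\prod_(i in Cdfall s) C i) *
  (\prod_(i in Cdrise s) D i) * (\prod_(i in Evenfix s) E i) * (\prod_(i in Oddfix s) F i) =
  prod_by_kind.
Proof.
move=> sD sw; have := has_word_support tau s; rewrite sD sw => /esym.
case/and4P=> /eqP/setP e1 /eqP/setP e2 /eqP/setP e3 /eqP/setP e4.
do 6 rewrite [\prod_(_ in _) _]big_mkcond /=; rewrite -!big_split; apply: eq_bigr => i _ /=.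
have := e1 i; have := e2 i; have := e3 i; have := e4 i; rewrite !inE => -> -> -> E1.
have -> : (s i == i) = (tau i == fixpoint).
  by have /forallP/(_ i)/eqP <- := sw; rewrite /kind_at; case: (s i == i).
rewrite E1 /label /= /up_start /down_start /up_end /down_end /by_kind.
by case: (odd i); case: (tau i) => [[]|] /=; rewrite ?mulr1 ?mul1r.
Qed.

Lemma prod_by_kind_start : prod_by_kind =
  (\prod_(x in [set i : 'I_m | up_start tau i]) if tau x == turn then A x else D x) *
  (\prod_(y in [set i : 'I_m | down_start tau i]) if tau y == turn then B y else C y) *
  \prod_(i < m | tau i == fixpoint) if odd i then E i else F i.
Proof.
do 2 rewrite [\prod_(_ in _) _]big_mkcond /=.
rewrite [X in _ * X]big_mkcond -!big_split; apply: eq_bigr => i _ /=.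
rewrite !inE /up_start /down_start /by_kind.
by case: (odd i); case: (tau i) => [[]|] /=; rewrite ?mulr1 ?mul1r.
Qed.

Lemma prod_by_kind_end : prod_by_kind =
  (\prod_(x in [set i : 'I_m | down_end tau i]) if tau x == turn then A x else C x) *
  (\prod_(y in [set i : 'I_m | up_end tau i]) if tau y == turn then B y else D y) *
  \prod_(i < m | tau i == fixpoint) if odd i then E i else F i.
Proof.
do 2 rewrite [\prod_(_ in _) _]big_mkcond /=.
rewrite [X in _ * X]big_mkcond -!big_split; apply: eq_bigr => i _ /=.
rewrite !inE /up_end /down_end /by_kind.
by case: (odd i); case: (tau i) => [[]|] /=; rewrite ?mulr1 ?mul1r.
Qed.

End KindProducts.

Section WordSums.

Variables (R : comNzRingType) (a b c d : nat -> nat -> R) (e f : nat -> R).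

(** [u] and [v] are the numbers of rises and falls before [i]. A valley is weighted at the height
    after it, every other kind at the height before. *)
Definition step_weight (i : nat) (k : kind) (u v : nat) : R :=
  by_kind (odd i) k (level_sum a (u.+1 - v)) (level_sum b (u - v)) (level_sum c (u - v))
    (level_sum d (u - v)) (e (u - v)%N) (f (u - v)%N).

Definition word_weight (tau : nat -> kind) (m : nat) : R :=
  \prod_(i < m) step_weight i (tau i) (cnt (rises tau) i) (cnt (falls tau) i).

Section FixedWord.

Variables (m : nat) (tau : nat -> kind).
Hypothesis balanced : cnt (rises tau) m = cnt (falls tau) m.

Local Notation US := [set i : 'I_m | up_start tau i] (only parsing).
Local Notation DS := [set i : 'I_m | down_start tau i] (only parsing).
Local Notation UE := [set i : 'I_m | up_end tau i] (only parsing).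
Local Notation DE := [set i : 'I_m | down_end tau i] (only parsing).

Let disj_start : [disjoint US & DS].
Proof.
rewrite -setI_eq0; apply/eqP/setP => i; rewrite !inE /up_start /down_start.
by case: (odd i); rewrite ?andbF.
Qed.

Let disj_end : [disjoint UE & DE].
Proof.
rewrite -setI_eq0; apply/eqP/setP => i; rewrite !inE /up_end /down_end.
by case: (odd i); case: (tau i) => [[]|].
Qed.

Let setU_start : US :|: DS = UE :|: DE.
Proof.
apply/setP => i; rewrite !inE /up_end /down_end /up_start /down_start.
by case: (odd i); case: (tau i) => [[]|].
Qed.

Let card_up : #|US| = #|UE|.
Proof. by rewrite !card_set_cnt cnt_up_start cnt_up_end balanced. Qed.

Let card_down : #|DS| = #|DE|.
Proof. by rewrite !card_set_cnt cnt_down_start cnt_down_end balanced. Qed.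

Let fixed_weight : R :=
  \prod_(i < m | tau i == fixpoint)
    if odd i then e (cnt (rises tau) i - cnt (falls tau) i)
    else f (cnt (rises tau) i - cnt (falls tau) i).

Let fixed_weightE (s : 'S_m) : Dperm s -> has_word tau s ->
  \prod_(i < m | tau i == fixpoint) (if odd i then e (psnest s i) else f (psnest s i)) = fixed_weight.
Proof.
move=> sD sw; apply: eq_bigr => i /eqP fixi.
rewrite (psnestE sD sw) //; have /forallP/(_ i) := sw.
by rewrite fixi /kind_at; case: (s i =P i).
Qed.

(* Seen from the right end, a balanced word has the same height after a step   *)
(* as seen from the left end.                                                  *)
Let height_after (p q r : pred nat) i : (i < m)%N ->
  (forall k, cnt p k = cnt (rises tau) k + cnt r k)%N ->
  (forall k, cnt q k = cnt (falls tau) k + cnt r k)%N ->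
  ((cnt q m - cnt q i.+1) - (cnt p m - cnt p i.+1) =
   cnt (rises tau) i.+1 - cnt (falls tau) i.+1)%N.
Proof.
move=> ltim pE qE; rewrite !pE !qE balanced.
have := leq_cnt (rises tau) ltim; have := leq_cnt (falls tau) ltim.
by have := leq_cnt r ltim; rewrite balanced; lia.
Qed.

Lemma sum_word_Q :
  \sum_(s : 'S_m | Dperm s && has_word tau s)
    ((\prod_(i in Cval s) a (ucross s i) (unest s i)) *
     (\prod_(i in Cpeak s) b (lcross s i) (lnest s i)) *
     (\prod_(i in Cdfall s) c (lcross s i) (lnest s i)) *
     (\prod_(i in Cdrise s) d (ucross s i) (unest s i)) *
     (\prod_(i in Evenfix s) e (psnest s i)) *
     (\prod_(i in Oddfix s) f (psnest s i))) = word_weight tau m.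
Proof.
transitivity (\sum_(s : 'S_m | has_support US DS UE DE s)
    (\prod_(x in US) (if tau x == turn then a else d) (ucross s x) (unest s x)) *
    (\prod_(y in DS) (if tau y == turn then b else c) (lcross s y) (lnest s y)) *
    fixed_weight).
  apply: eq_big => s; first exact: has_word_support.
  case/andP=> sD sw; rewrite (prod_by_kindE _ _ _ _ _ _ sD sw) prod_by_kind_start.
  congr (_ * _ * _); last exact: fixed_weightE.
    by apply: eq_bigr => i _; case: ifP.
  by apply: eq_bigr => i _; case: ifP.
rewrite -mulr_suml
  (sum_cross_nest (fun x : 'I_m => if tau x == turn then a else d)
  (fun y : 'I_m => if tau y == turn then b else c)) // /word_weight /step_weight prod_by_kind_start.
congr (_ * _ * _); apply: eq_bigr => i; rewrite inE => start_i.
  rewrite !below_down_key (height_after (ltn_ord i) (cnt_up_start tau) (cnt_up_end tau)) !cntS.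
  by move: start_i; rewrite /up_start /rises /falls; case: (odd i) => //=;
     case: (tau i) => [[]|] //= _; rewrite ?addn0 ?addn1.
rewrite !below_up_key cnt_down_end cnt_down_start subnDr.
by case: (tau i == turn).
Qed.

Lemma sum_word_Q' :
  \sum_(s : 'S_m | Dperm s && has_word tau s)
    ((\prod_(i in Cval s) a (lcross' s i) (lnest' s i)) *
     (\prod_(i in Cpeak s) b (ucross' s i) (unest' s i)) *
     (\prod_(i in Cdfall s) c (lcross' s i) (lnest' s i)) *
     (\prod_(i in Cdrise s) d (ucross' s i) (unest' s i)) *
     (\prod_(i in Evenfix s) e (psnest s i)) *
     (\prod_(i in Oddfix s) f (psnest s i))) = word_weight tau m.
Proof.
transitivity (\sum_(s : 'S_m | has_support DE UE DS US s)
    (\prod_(x in DE) (if tau x == turn then a else c) (ucross s x) (unest s x)) *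
    (\prod_(y in UE) (if tau y == turn then b else d) (lcross s y) (lnest s y)) *
    fixed_weight).
  (* Passing to the inverse turns arc ends into arc starts, hence the swapped endpoint sets. *)
  rewrite [RHS](reindex_inj invg_inj) /=; apply: eq_big => s.
    rewrite has_word_support /has_support invgK.
    by rewrite andbC -!andbA; do !bool_congr.
  case/andP=> sD sw; rewrite (prod_by_kindE _ _ _ _ _ _ sD sw) prod_by_kind_end.
  congr (_ * _ * _); last exact: fixed_weightE.
    by apply: eq_bigr => i _; rewrite lcross'E lnest'E; case: ifP.
  by apply: eq_bigr => i _; rewrite ucross'E unest'E; case: ifP.
rewrite -mulr_suml
  (sum_cross_nest (fun x : 'I_m => if tau x == turn then a else c)
  (fun y : 'I_m => if tau y == turn then b else d)) // /word_weight /step_weight; first last.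
- by rewrite setUC -setU_start setUC.
- by rewrite disjoint_sym.
- by rewrite disjoint_sym.
rewrite prod_by_kind_end.
congr (_ * _ * _); apply: eq_bigr => i; rewrite inE => end_i.
  rewrite !below_down_key (height_after (ltn_ord i) (cnt_down_end tau) (cnt_down_start tau)) !cntS.
  by move: end_i; rewrite /down_end /rises /falls; case: (odd i) => //=;
     case: (tau i) => [[]|] //= _; rewrite ?addn0 ?addn1.
rewrite !below_up_key cnt_up_end cnt_up_start subnDr.
by case: (tau i == turn).
Qed.

End FixedWord.
End WordSums.

(** * Weighted lattice paths *)

(** Upper arcs have as many starts as ends, and double rises count once in each. *)
Lemma word_balanced m (tau : nat -> kind) (s : 'S_m) :
  Dperm s -> has_word tau s -> cnt (rises tau) m = cnt (falls tau) m.
Proof.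
move=> sD sw; have := has_word_support tau s; rewrite sD sw => /esym.
case/and4P=> /eqP e1 _ /eqP e3 _; have := card_aexcV s; rewrite e1 e3.
by rewrite !card_set_cnt cnt_up_start cnt_up_end; lia.
Qed.

Lemma sum_kind (V : nmodType) (F : kind -> V) :
  \sum_x F x = F turn + F through + F fixpoint.
Proof.
rewrite (bigD1 turn) // (bigD1 through) // (bigD1 fixpoint) // big1 /= => [|[[]|] //].
by rewrite addr0 addrA.
Qed.

Lemma sum_tuple_rcons (V : nmodType) (T : finType) k (F : k.+1.-tuple T -> V) :
  \sum_t F t = \sum_x \sum_(t : k.-tuple T) F [tuple of rcons t x].
Proof.
rewrite (exchange_big_dep xpredT) //= pair_big /=.
rewrite (reindex (fun p : k.-tuple T * T => [tuple of rcons p.1 p.2])) //=.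
exists (fun t => ([tuple of belast (thead t) (behead t)], last (thead t) (behead t))) => [[t x] _|t _].
  congr (_, _); last by case: t => [[|y t] ?] //=; rewrite last_rcons.
  by apply: val_inj; case: t => [[|y t] ?] //=; rewrite belast_rcons.
by apply: val_inj; case/tupleP: t => x t /=; rewrite -lastI theadE.
Qed.

Section PathSums.

Variables (R : comNzRingType) (a b c d : nat -> nat -> R) (e f : nat -> R).

Local Notation weight := (word_weight a b c d e f).

(** The first step below height 0 is a cycle peak at height 0, whose factor is an empty
    [level_sum]. *)
Lemma word_weight_infeasible tau k :
  (cnt (rises tau) k < cnt (falls tau) k)%N -> weight tau k = 0.
Proof.
elim: k => [|k IHk]; first by rewrite /cnt !big_ord0.
rewrite !cntS /word_weight big_ord_recr /= => lt_k1.
have [lt_k|le_k] := ltnP (cnt (rises tau) k) (cnt (falls tau) k).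
  by rewrite -/(weight tau k) IHk // mul0r.
have [odd_k tau_k] : odd k /\ tau k = turn.
  have : falls tau k by move: lt_k1 le_k; case: (falls tau k); lia.
  by case/andP=> -> /eqP.
have -> : (cnt (rises tau) k = cnt (falls tau) k)%N.
  move: lt_k1.
  have -> : rises tau k = false by rewrite /rises odd_k.
  have falls_k : falls tau k by rewrite /falls odd_k tau_k.
  by rewrite falls_k; lia.
by rewrite /step_weight /by_kind odd_k tau_k subnn /level_sum big_geq // mulr0.
Qed.

(* Words that go below height 0 need not be excluded: their weight is zero, by *)
(* [word_weight_infeasible].                                                   *)
Definition path_sum k h : R :=
  \sum_(t : k.-tuple kind |
      cnt (rises (nth fixpoint t)) k == (cnt (falls (nth fixpoint t)) k + h)%N)
    weight (nth fixpoint t) k.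

Lemma eq_word_weight tau1 tau2 k :
  (forall i, (i < k)%N -> tau1 i = tau2 i) -> weight tau1 k = weight tau2 k.
Proof.
move=> eq12; apply: eq_bigr => i _; rewrite eq12 //.
by congr (step_weight _ _ _ _ _ _ _ _ _ _); apply: eq_cnt => j ltji;
   rewrite /rises /falls eq12 // (ltn_trans ltji).
Qed.

Lemma path_sum0 h : path_sum 0 h = (h == 0%N)%:R.
Proof.
rewrite /path_sum /word_weight /cnt; case: h => [|h].
  rewrite (big_pred1 [tuple]) ?big_ord0 // => t.
  by rewrite !big_ord0; apply/esym/eqP; rewrite [t]tuple0.
by rewrite big_pred0 // => t; rewrite !big_ord0.
Qed.

Lemma path_sumS k h :
  path_sum k.+1 h = \sum_x \sum_(t : k.-tuple kind)
    if (cnt (rises (nth fixpoint t)) k + (~~ odd k && (x == turn)) ==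
        cnt (falls (nth fixpoint t)) k + (odd k && (x == turn)) + h)%N
    then weight (nth fixpoint t) k *
      step_weight a b c d e f k x (cnt (rises (nth fixpoint t)) k) (cnt (falls (nth fixpoint t)) k)
    else 0.
Proof.
rewrite /path_sum big_mkcond sum_tuple_rcons /=.
apply: eq_bigr => x _; apply: eq_bigr => t _.
have eq_lt i : (i < k)%N -> nth fixpoint (rcons t x) i = nth fixpoint t i.
  by move=> ltik; rewrite nth_rcons size_tuple ltik.
have eq_k : nth fixpoint (rcons t x) k = x by rewrite nth_rcons size_tuple ltnn eqxx.
have eq_r : cnt (rises (nth fixpoint (rcons t x))) k = cnt (rises (nth fixpoint t)) k.
  by apply: eq_cnt => i ltik; rewrite /rises eq_lt.
have eq_f : cnt (falls (nth fixpoint (rcons t x))) k = cnt (falls (nth fixpoint t)) k.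
  by apply: eq_cnt => i ltik; rewrite /falls eq_lt.
rewrite !cntS eq_r eq_f [rises _ k]/rises [falls _ k]/falls eq_k; case: ifP => // _.
by rewrite /word_weight big_ord_recr /= eq_r eq_f eq_k -/(weight _ k) (eq_word_weight eq_lt).
Qed.

Lemma path_sum_flat k h x (w : R) : x != turn ->
  (forall v, step_weight a b c d e f k x (v + h) v = w) ->
  \sum_(t : k.-tuple kind)
    (if (cnt (rises (nth fixpoint t)) k + (~~ odd k && (x == turn)) ==
        cnt (falls (nth fixpoint t)) k + (odd k && (x == turn)) + h)%N
    then weight (nth fixpoint t) k *
      step_weight a b c d e f k x (cnt (rises (nth fixpoint t)) k) (cnt (falls (nth fixpoint t)) k)
    else 0) = path_sum k h * w.
Proof.
move=> /negPf neqx wE; rewrite /path_sum mulr_suml [RHS]big_mkcond; apply: eq_bigr => t _.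
by rewrite neqx !andbF !addn0; case: eqP => // ->; rewrite wE.
Qed.

Lemma path_sumS_even k h : ~~ odd k ->
  path_sum k.+1 h = (if h is h'.+1 then path_sum k h' * level_sum a h else 0) +
                    path_sum k h * (level_sum d h + f h).
Proof.
move=> even_k; have /negPf odd_k := even_k.
rewrite path_sumS sum_kind.
rewrite (@path_sum_flat _ _ through (level_sum d h)) //; last first.
  by move=> v; rewrite /step_weight /by_kind odd_k addKn.
rewrite (@path_sum_flat _ _ fixpoint (f h)) //; last first.
  by move=> v; rewrite /step_weight /by_kind odd_k addKn.
rewrite mulrDr addrA; congr (_ + _ + _).
case: h => [|h].
  (* A rise ending at height 0 starts below 0, so the prefix has weight zero. *)
  apply: big1 => t _; rewrite odd_k /= !addn0 addn1; case: eqP => // eqS.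
  by rewrite word_weight_infeasible ?mul0r // -eqS.
rewrite /path_sum mulr_suml [RHS]big_mkcond; apply: eq_bigr => t _.
rewrite odd_k /= !addn0 addn1 addnS eqSS; case: eqP => // ->.
by rewrite /step_weight /by_kind odd_k -addnS addKn.
Qed.

Lemma path_sumS_odd k h : odd k ->
  path_sum k.+1 h = path_sum k h.+1 * level_sum b h.+1 +
                    path_sum k h * (level_sum c h + e h).
Proof.
move=> odd_k; rewrite path_sumS sum_kind.
rewrite (@path_sum_flat _ _ through (level_sum c h)) //; last first.
  by move=> v; rewrite /step_weight /by_kind odd_k addKn.
rewrite (@path_sum_flat _ _ fixpoint (e h)) //; last first.
  by move=> v; rewrite /step_weight /by_kind odd_k addKn.
rewrite mulrDr addrA; congr (_ + _ + _).
rewrite /path_sum mulr_suml [RHS]big_mkcond; apply: eq_bigr => t _.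
rewrite odd_k /= !addn0 -addnA add1n; case: eqP => // ->.
by rewrite /step_weight /by_kind odd_k addKn.
Qed.

(** Rises occur only at even positions, so [k] letters contain at most (k + 1) / 2 of them. *)
Lemma path_sum_too_high k h : (k.+1 < h.*2)%N -> path_sum k h = 0.
Proof.
elim: k h => [|k IHk] h lt_kh; first by rewrite path_sum0; case: h lt_kh.
have [odd_k|even_k] := boolP (odd k).
  by rewrite path_sumS_odd // !IHk ?mul0r ?addr0 //; move: lt_kh; rewrite ?doubleS; lia.
rewrite path_sumS_even // [path_sum k h]IHk; last exact: ltnW.
rewrite mul0r addr0.
case: h lt_kh => // h; rewrite doubleS => lt_kh; rewrite IHk ?mul0r //.
have : k.+1 != h.*2 by apply: contraNneq even_k => eqk; rewrite -[odd k]negbK -oddS eqk odd_double.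
lia.
Qed.

Lemma sum_by_words m (W : 'S_m -> R) :
  (forall tau, cnt (rises tau) m = cnt (falls tau) m ->
     \sum_(s : 'S_m | Dperm s && has_word tau s) W s = weight tau m) ->
  \sum_(s : 'S_m | Dperm s) W s = path_sum m 0.
Proof.
move=> sumW.
rewrite (partition_big (fun s => [tuple kind_at s i | i < m]) xpredT) //= /path_sum.
rewrite [RHS]big_mkcond; apply: eq_bigr => t _; rewrite addn0.
have eq_word (s : 'S_m) : ([tuple kind_at s i | i < m] == t) = has_word (nth fixpoint t) s.
  apply/eqP/forallP => [<- i|eqt]; first by rewrite -tnth_nth tnth_mktuple.
  by apply: eq_from_tnth => i; rewrite tnth_mktuple (tnth_nth fixpoint); apply/eqP.
case: eqP => [balanced|unbalanced].
  rewrite -(sumW _ balanced).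
  by apply: eq_bigl => s; rewrite eq_word.
apply: big_pred0 => s; rewrite eq_word; apply/negP=> /andP[sD sw].
exact: unbalanced (word_balanced sD sw).
Qed.

(** In the new height [H] a word of length [H + j.*2] ends at old height [uphalf H]; [rise H] and
    [fall H] weight the steps from [H] to [H + 1] and [H - 1]. *)
Lemma is_tfrac_path_sum (alpha delta : nat -> R) :
  (forall k, alpha k.*2.+1 = level_sum a k.+1 * level_sum b k.+1) ->
  (forall k, alpha k.+1.*2 =
     (e k.+1 + level_sum c k.+1) * (f k.+1 + level_sum d k.+1)) ->
  delta 1%N = e 0%N * f 0%N -> (forall n, delta n.+2 = 0) ->
  is_tfrac alpha delta (fun n => path_sum n.*2 0).
Proof.
move=> alpha_odd alpha_even delta1 delta0.
pose rise H := if odd H then level_sum c (uphalf H) + e (uphalf H) else level_sum a (uphalf H).+1.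
pose fall H := if odd H then level_sum b (uphalf H) else level_sum d (uphalf H) + f (uphalf H).
apply: (@is_tfrac_heights _ rise fall _ _ (fun H j => path_sum (H + j.*2) (uphalf H))) => //.
- move=> H; rewrite /rise /fall /= -[H]odd_double_half; case: (odd H); rewrite ?add0n ?add1n.
    rewrite /= odd_double /= doubleK uphalf_double -doubleS alpha_even.
    by rewrite addrC [f _ + _]addrC.
  by rewrite odd_double /= uphalf_double doubleK alpha_odd.
- case=> [|j]; first by rewrite path_sum0.
  (* Unfolding two letters exposes the detour through new height -1: a factor [f 0], then [e 0]. *)
  rewrite add0n doubleS path_sumS_odd /= ?odd_double // !path_sumS_even ?odd_double //.
  have level_sum0 g : level_sum g 0 = 0 :> R by rewrite /level_sum big_geq.
  by rewrite /fall /= delta1 !level_sum0 !add0r; ring.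
move=> H j; rewrite /rise /fall addSn /= negbK.
have [odd_H|even_H] := boolP (odd H).
  have -> : (uphalf H = H./2.+1)%N by rewrite uphalf_half odd_H.
  rewrite path_sumS_odd ?oddD ?odd_double ?addbF // [LHS]addrC.
  congr (_ + _); first exact: mulrC.
  (* For [j = 0] the word is too short to have been above its final new height. *)
  case: j => [|j]; first by rewrite path_sum_too_high ?mul0r //; lia.
  by rewrite mulrC doubleS !addnS !addSn.
have -> : (uphalf H = H./2)%N by rewrite uphalf_half (negPf even_H).
rewrite path_sumS_even ?oddD ?odd_double ?addbF //.
congr (_ + _); first exact: mulrC.
case: j => [|j]; first by rewrite path_sum_too_high ?mul0r //; lia.
by rewrite mulrC doubleS !addnS !addSn.
Qed.

End PathSums.

Theorem theorem3p12 (R : comNzRingType)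
    (a b c d : nat -> nat -> R) (e f : nat -> R) :
  (forall alpha delta : nat -> R,
     (forall k : nat, (1 <= k)%N ->
        alpha (2 * k - 1)%N =
          (\sum_(0 <= xi < k) a (k - 1 - xi)%N xi) *
          (\sum_(0 <= xi < k) b (k - 1 - xi)%N xi)) ->
     (forall k : nat, (1 <= k)%N ->
        alpha (2 * k)%N =
          (e k + \sum_(0 <= xi < k) c (k - 1 - xi)%N xi) *
          (f k + \sum_(0 <= xi < k) d (k - 1 - xi)%N xi)) ->
     delta 1%N = e 0%N * f 0%N ->
     (forall n : nat, (2 <= n)%N -> delta n = 0) ->
     is_tfrac alpha delta (Q' a b c d e f))
  /\ (forall n : nat, Q a b c d e f n = Q' a b c d e f n).
Proof.
have QE n : Q a b c d e f n = path_sum a b c d e f (2 * n) 0.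
  by apply: sum_by_words => tau; apply: sum_word_Q.
have Q'E n : Q' a b c d e f n = path_sum a b c d e f (2 * n) 0.
  by apply: sum_by_words => tau; apply: sum_word_Q'.
split=> [alpha delta alpha_odd alpha_even delta1 delta0 n|n]; last by rewrite QE Q'E.
have alpha_odd' k : alpha k.*2.+1 = level_sum a k.+1 * level_sum b k.+1.
  by rewrite -[RHS]alpha_odd // mulnS addSn subn1 mul2n.
have alpha_even' k :
    alpha k.+1.*2 = (e k.+1 + level_sum c k.+1) * (f k.+1 + level_sum d k.+1).
  by rewrite -[RHS]alpha_even // mul2n.
have delta0' k : delta k.+2 = 0 by apply: delta0.
have [N0 N0P] := is_tfrac_path_sum alpha_odd' alpha_even' delta1 delta0' n.
by exists N0 => N leN; rewrite Q'E mul2n N0P.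
Qed.
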